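(* Let $n$ be a positive integer with $n\le 9$ and let $a=(a_1,\ldots,a_n)\in\mathbb{R}^n$. Let $\mathcal{S}=\{+1,-1\}^n$, and for $\varepsilon=(\varepsilon^1,\ldots,\varepsilon^n)\in\mathcal{S}$ write $\varepsilon a=\sum_{i=1}^n\varepsilon^i a_i$. Then the set $\{\varepsilon\in\mathcal{S}\mid |\varepsilon a|\le\|a\|\}$ contains at least half of the elements of $\mathcal{S}$, i.e. it has at least $2^{n-1}$ elements.
   Context: $\|a\|=\left(\sum_{i=1}^n a_i^2\right)^{1/2}$ denotes the Euclidean norm. Superscripts on $\varepsilon$ are coordinate indices, not powers. *)

(* Defs.v *)
From mathcomp Require Import all_boot all_order all_algebra.
From mathcomp Require Import reals.

Set Implicit Arguments.
Unset Strict Implicit.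
Unset Printing Implicit Defensive.

Import Order.TTheory GRing.Theory Num.Theory.

Local Open Scope ring_scope.

(* A sign vector in {+1,-1}^n is encoded by booleans: its i-th coordinate is
   (-1) ^+ e i, i.e., +1 if e i = false and -1 if e i = true. *)
Definition signed_sum (R : realType) (n : nat) (e : {ffun 'I_n -> bool})
    (a : 'rV[R]_n) : R :=
  \sum_(i < n) (-1) ^+ e i * a 0 i.

(* The norm `|a| that MathComp-Analysis puts on 'rV[R]_n is the sup norm. *)
Definition enorm (R : realType) (n : nat) (a : 'rV[R]_n) : R :=
  Num.sqrt (\sum_(i < n) a 0 i ^+ 2).

(* Main.v *)
Require Import Defs.
From mathcomp Require Import all_boot all_order all_algebra.
From mathcomp Require Import reals.
From mathcomp Require Import ring lra.
From Stdlib Require Import Ascii String.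

(** The signed sums do not change, as a multiset, when the entries of [a] are
    permuted or negated, and appending a zero entry repeats each of them twice;
    so it is enough to treat nine entries [z_1 >= ... >= z_9 >= 0].  Put
    [t = |z|] and let [F] be the set of the sign vectors [c] with [c.z > t].
    Since [c |-> -c] exchanges the sums above [t] with those below [-t], the
    claim says that [F] has at most [2 ^ 7] elements.  Two facts limit [F].

    - Averages of members of [F] are long.  Say that [y] dominates [v] when
      each prefix sum of [y] is at least that of [v]; as [z] is nonnegative and
      nonincreasing, this gives [v.z <= y.z] by Abel summation ([dominates_dot]).
      If [v] is a weighted average of members of [F] and [y] dominates [v], then
      [t < v.z <= y.z <= |y| t] by the Cauchy-Schwarz inequality, whence
      [|y| > 1].  A set of sign vectors with a weighted average that is dominated by
      some [y] with [|y| <= 1] therefore cannot lie in [F] ([void_false]).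

    - Flipping all signs but the first pairs up the sign vectors, and two
      partners [c], [c'] are never both in [F]: their sum [c.z + c'.z] is
      [2 z_1] or [- 2 z_1], and [z_1 <= t].  So [F] has at most as many elements
      as there are pairs, [2 ^ 8], and a factor [2] is to be gained: half of
      the pairs must be shown to miss [F] altogether ([few_count]).

    The sign vectors that lie in [F] depend on [z], but only finitely much has
    to be known about them.  A decision tree asks whether [c.z > t] for
    well-chosen sign vectors [c].  Along each of its branches either the
    vectors known to be in [F] contradict the first fact, or the vectors known
    to be outside [F], together with everything they dominate, fill half of the
    pairs.  The tree [certificate] was found by a computer search, in which
    shortest averages were computed by quadratic programming; that it has these
    properties is verified by evaluating [check] ([certificate_valid]), and
    [check_count] is the soundness of this evaluation. *)

Set Implicit Arguments.
Unset Strict Implicit.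
Unset Printing Implicit Defensive.

Import Order.TTheory GRing.Theory Num.Theory.

Local Open Scope ring_scope.

(** * Integer vectors acting on real vectors *)

(** Lists of different lengths are paired up to the shorter one, so that the
    empty list is a zero vector and no length hypotheses are needed below. *)
Fixpoint dot (R : realType) (c : seq int) (x : seq R) : R :=
  match c, x with
  | k :: c', r :: x' => k%:~R * r + dot c' x'
  | _, _ => 0
  end.

Fixpoint addv (c d : seq int) : seq int :=
  match c, d with
  | k :: c', l :: d' => (k + l) :: addv c' d'
  | [::], _ => d
  | _, [::] => c
  end.

Definition oppv : seq int -> seq int := map -%R.

Lemma dot_addv (R : realType) c d (x : seq R) :
  dot (addv c d) x = dot c x + dot d x.
Proof.
elim: c d x => [|k c IH] [|l d] [|r x] //=; rewrite ?add0r ?addr0 //.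
by rewrite IH intrD; ring.
Qed.

Lemma dot_map_mul (R : realType) (w : int) c (x : seq R) :
  dot (map ( *%R w) c) x = w%:~R * dot c x.
Proof.
elim: c x => [|k c IH] [|r x] /=; rewrite ?mulr0 // IH intrM; ring.
Qed.

Lemma dot_oppv (R : realType) c (x : seq R) : dot (oppv c) x = - dot c x.
Proof.
elim: c x => [|k c IH] [|r x] /=; rewrite ?oppr0 // IH rmorphN; ring.
Qed.

Definition sumsq (R : realType) (x : seq R) : R := \sum_(r <- x) r ^+ 2.

Lemma cauchy_schwarz (R : realType) (y : seq int) (x : seq R) :
  dot y x ^+ 2 <= (\sum_(k <- y) k ^+ 2)%:~R * sumsq x.
Proof.
have sumsq_ge0 (z : seq R) : 0 <= sumsq z by apply: sumr_ge0 => r _; exact: sqr_ge0.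
have isum_ge0 (z : seq int) : 0 <= (\sum_(k <- z) k ^+ 2)%:~R :> R.
  by rewrite ler0z; apply: sumr_ge0 => r _; exact: sqr_ge0.
elim: y x => [|k y IH] [|r x] /=.
- by rewrite expr0n /= mulr_ge0.
- by rewrite expr0n /= mulr_ge0.
- by rewrite expr0n /= mulr_ge0.
rewrite /sumsq !big_cons rmorphD rmorphXn /= -/(sumsq x).
move: (IH x) (isum_ge0 y) (sumsq_ge0 x).
set Y := (\sum_(k <- y) _)%:~R; set X := sumsq x; set D := dot y x.
set b : R := k%:~R => DYX Y0 X0.
have rhs0 : 0 <= b ^+ 2 * X + r ^+ 2 * Y by rewrite addr_ge0 // mulr_ge0 ?sqr_ge0.
have cross : 2 * (b * r) * D <= b ^+ 2 * X + r ^+ 2 * Y.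
  apply: (le_trans (ler_norm _)).
  rewrite -(ler_pXn2r (n := 2)) ?nnegrE // real_normK ?num_real //.
  have brD : (b * r) ^+ 2 * D ^+ 2 <= (b * r) ^+ 2 * (Y * X).
    by apply: ler_wpM2l => //; exact: sqr_ge0.
  rewrite -subr_ge0; have -> : (b ^+ 2 * X + r ^+ 2 * Y) ^+ 2 - (2 * (b * r) * D) ^+ 2 =
    (b ^+ 2 * X - r ^+ 2 * Y) ^+ 2 + 4 * ((b * r) ^+ 2 * (Y * X) - (b * r) ^+ 2 * D ^+ 2).
    by ring.
  by rewrite addr_ge0 ?sqr_ge0 // mulr_ge0 ?subr_ge0.
have -> : (b * r + D) ^+ 2 = b ^+ 2 * r ^+ 2 + 2 * (b * r) * D + D ^+ 2 by ring.
have -> : (b ^+ 2 + Y) * (r ^+ 2 + X) =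
  b ^+ 2 * r ^+ 2 + (b ^+ 2 * X + r ^+ 2 * Y) + Y * X by ring.
by rewrite !lerD.
Qed.

(** * Domination *)

(** [dom 0 c d] says that [c] and [d] have the same length and that each prefix
    sum of [c] is at most that of [d]; the accumulator [s] is the excess of the
    prefix sum of [d] over that of [c] in the part already read. *)
Fixpoint dom (s : int) (c d : seq int) : bool :=
  match c, d with
  | [::], [::] => true
  | k :: c', l :: d' => (0 <= s + (l - k)) && dom (s + (l - k)) c' d'
  | _, _ => false
  end.

Fixpoint nonincr (R : realType) (h : R) (x : seq R) : bool :=
  if x is r :: x' then (0 <= r <= h) && nonincr r x' else 0 <= h.

(** Abel summation: the excess [s] accumulated so far was gained at entries of
    size at least [h], hence it can be spent on the smaller entries to come. *)
Lemma dominates_dot (R : realType) (h : R) (x : seq R) s c d :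
  nonincr h x -> dom s c d -> 0 <= s -> dot c x <= dot d x + s%:~R * h.
Proof.
elim: x h s c d => [|r x IH] h s [|k c] [|l d] //=.
- by move=> h0 _ s0; rewrite add0r mulr_ge0 // ler0z.
- by move=> h0 _ s0; rewrite add0r mulr_ge0 // ler0z.
- move=> /andP[/andP[r0 rh] _] _ s0; rewrite add0r mulr_ge0 ?ler0z //; lra.
case/andP=> /andP[r0 rh] mono /andP[s1 dcd] s0.
have := IH _ _ _ _ mono dcd s1; rewrite !rmorphD rmorphN /=.
have : s%:~R * r <= s%:~R * h by apply: ler_wpM2l => //; rewrite ler0z.
lra.
Qed.

Lemma nonincr_sorted (R : realType) (h : R) (x : seq R) :
  path >=%R h x -> all (>= 0) x -> 0 <= h -> nonincr h x.
Proof. by elim: x h => //= r x IH h /andP[-> /IH {}IH] /andP[r0 /IH ->] //; rewrite r0. Qed.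

(** * Sign vectors *)

Fixpoint signs (n : nat) : seq (seq int) :=
  if n is m.+1 then map (cons 1) (signs m) ++ map (cons (-1)) (signs m)
  else [:: [::]].

Lemma size_signs n : size (signs n) = (2 ^ n)%N.
Proof. by elim: n => //= n IH; rewrite size_cat !size_map IH addnn -mul2n expnS. Qed.

Lemma mem_signs n c :
  (c \in signs n) = (size c == n) && all (fun k => (k == 1) || (k == -1)) c.
Proof.
elim: n c => [|n IH] [|k c] //=; rewrite mem_cat.
  by apply/negbTE; rewrite negb_or; apply/andP; split; apply/mapP => -[].
have consK (l : int) : ((k :: c) \in map (cons l) (signs n)) = (k == l) && (c \in signs n).
  apply/mapP/andP => [[d dS [-> ->]]|[/eqP -> cS]]; first by rewrite eqxx.
  by exists c.
by rewrite !consK IH eqSS -andb_orl andbCA.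
Qed.

Lemma oppv_signs n : perm_eq (map oppv (signs n)) (signs n).
Proof.
elim: n => //= n IH; rewrite map_cat perm_catC; apply: perm_cat.
- rewrite -(permPr (perm_map (cons 1) IH)) -!map_comp.
  by rewrite (@eq_map _ _ _ (cons 1 \o oppv)) // => c; rewrite /= opprK.
- rewrite -(permPr (perm_map (cons (-1)) IH)) -!map_comp.
  by rewrite (@eq_map _ _ _ (cons (-1) \o oppv)).
Qed.

(** The partner of a sign vector: two partners agree in the first coordinate
    only, so half their sum is a unit vector. *)
Definition partner (c : seq int) : seq int :=
  if c is k :: c' then k :: oppv c' else [::].

Lemma partner_signs n : perm_eq (map partner (signs n)) (signs n).
Proof.
case: n => //= n; rewrite map_cat; apply: perm_cat.
- by rewrite -map_comp (@eq_map _ _ _ (cons 1 \o oppv)) // map_comp perm_map // oppv_signs.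
- by rewrite -map_comp (@eq_map _ _ _ (cons (-1) \o oppv)) // map_comp perm_map // oppv_signs.
Qed.

Lemma head_signs n c :
  c \in signs n.+1 -> exists c', c = 1 :: c' \/ c = -1 :: c'.
Proof. by rewrite mem_cat => /orP[] /mapP[c' _ ->]; exists c'; [left|right]. Qed.

(** * Decision trees *)

(** Sign vectors in a certificate are written as strings of [+] and [-]. *)
Definition signvec (s : string) : seq int :=
  [seq if a is "-"%char then -1 else 1 | a <- list_ascii_of_string s].

(** [Branch s T1 T2] asks whether [s.z > t] and continues with [T1] if so and
    with [T2] if not.  [Void ws y] ends a branch that cannot occur: [y] dominates
    the combination of known members of [F] with the weights in [ws], and is not
    longer than the total weight.  It carries integers instead of an average so
    as to avoid fractions.  [Few] ends a branch where enough sign vectors are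
    known to lie outside [F]. *)
Inductive tree : Type :=
| Few
| Void of seq (nat * string) & seq nat
| Branch of string & tree & tree.

Definition comb (ws : seq (nat * string)) : seq int :=
  foldr (fun p v => addv (map ( *%R p.1%:Z) (signvec p.2)) v) [::] ws.
Definition weight (ws : seq (nat * string)) : nat := foldr (fun p => addn p.1) 0%N ws.

(** A pair [{c, partner c}] is counted twice here, once for each of its members, so
    the bound means that at most half of the [2 ^ n.-1] pairs may meet [F]. *)
Definition few (n : nat) (O : seq (seq int)) : bool :=
  let out c := has (dom 0 c) O in
  (count (fun c => ~~ (out c && out (partner c))) (signs n) <= 2 ^ n.-1)%N.

Definition void (I : seq (seq int)) ws (y : seq nat) : bool :=
  let: W := weight ws in
  [&& (0 < W)%N, all (fun p => signvec p.2 \in I) ws,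
      dom 0 (comb ws) (map Posz y) & (foldr (fun k s => k * k + s) 0 y <= W * W)%N].

(** [I] lists vectors [c] with [c.z > t] and [O] vectors with [c.z <= t].  As
    [t >= 0], learning that [c.z > t] also tells that [- c] is outside [F]. *)
Fixpoint check (n : nat) (T : tree) (I O : seq (seq int)) : bool :=
  match T with
  | Few => few n O
  | Void ws y => void I ws y
  | Branch s T1 T2 =>
      let c := signvec s in
      check n T1 (c :: I) (oppv c :: O) && check n T2 I (c :: O)
  end.

(** * Soundness of decision trees *)

Section Soundness.
Variables (R : realType) (r0 : R) (x : seq R) (t : R).
Hypotheses (mono : nonincr r0 (r0 :: x)) (t0 : 0 <= t).
Hypothesis (tx : sumsq (r0 :: x) = t ^+ 2).
Let z := r0 :: x.

Lemma head_ge0 : 0 <= r0.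
Proof. by have /andP[/andP[]] := mono. Qed.

Lemma head_le : r0 <= t.
Proof.
rewrite -(ler_pXn2r (n := 2)) ?nnegrE ?head_ge0 // -tx /sumsq big_cons lerDl.
by apply: sumr_ge0 => ? _; exact: sqr_ge0.
Qed.

(** Counting [F] twice, once through [partner], gives the size of the union of [F]
    and its image, because the two are disjoint; and a vector of this union is
    not outside [F] together with its partner. *)
Lemma few_count n O : (0 < n)%N -> few n O -> {in O, forall c, dot c z <= t} ->
  (2 * count (fun c => (t < dot c z)%R) (signs n) <= 2 ^ n.-1)%N.
Proof.
case: n => // n _ fewO Ole; apply: leq_trans fewO; set S := signs n.+1.
pose out c := has (dom 0 c) O; pose F c := t < dot c z.
have outF c : out c -> ~~ F c.
  case/hasP=> d dO dcd; rewrite -leNgt.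
  have := dominates_dot mono dcd (lexx 0); rewrite mul0r addr0 => /le_trans.
  by apply; exact: Ole.
have -> : (2 * count F S = count (predU F (F \o partner)) S)%N.
  have := count_predUI F (F \o partner) S.
  rewrite -(count_map partner) (permP (partner_signs n.+1)) -/S addnn -mul2n => <-.
  rewrite [X in (_ + X)%N](_ : _ = 0%N) ?addn0 //.
  apply/eqP; rewrite -leqn0 leqNgt -has_count; apply/hasPn => c cS /=.
  apply/negP => /andP[]; have [c' [] ->] := head_signs cS;
    rewrite /F /= dot_oppv ?mul1r ?mulN1r; have := head_le; have := head_ge0; lra.
apply: sub_count => c /=; apply: contraTN => /andP[/outF nF /outF nG].
by rewrite negb_or nF.
Qed.

(** The inequality is strict because some weight is positive. *)
Lemma comb_lt (I : seq (seq int)) ws : {in I, forall c, t < dot c z} ->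
  all (fun p => signvec p.2 \in I) ws -> (0 < weight ws)%N ->
  (weight ws)%:R * t < dot (comb ws) z.
Proof.
move=> It; have le ws' : all (fun p => signvec p.2 \in I) ws' ->
    (weight ws')%:R * t <= dot (comb ws') z.
  elim: ws' => [|[w s] ws' IH] /=; first by rewrite mul0r.
  case/andP => sI /IH {}IH; rewrite natrD mulrDl dot_addv dot_map_mul.
  by apply: lerD => //; apply: ler_wpM2l => //; apply/ltW/It.
elim: ws => [|[w s] ws IH] //= /andP[sI wsI] W0.
rewrite natrD mulrDl dot_addv dot_map_mul.
case: w W0 => [|w] W0; first by rewrite !mul0r !add0r; exact: IH.
by apply: ltr_leD (le _ wsI); rewrite ltr_pM2l ?ltr0n //; exact: It.
Qed.

Lemma sumsq_nat (y : seq nat) :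
  (\sum_(k <- map Posz y) k ^+ 2)%:~R = (foldr (fun k s => k * k + s) 0 y)%N%:R :> R.
Proof.
elim: y => [|k y IH] /=; first by rewrite big_nil.
by rewrite big_cons rmorphD /= IH natrD natrM rmorphXn expr2.
Qed.

Lemma void_false I ws y : void I ws y -> {in I, forall c, t < dot c z} -> False.
Proof.
case/and4P => W0 wsI dcy yW It.
have := comb_lt It wsI W0.
have := dominates_dot mono dcy (lexx 0); rewrite mul0r addr0 => ley ltc.
have {ley ltc} : (weight ws)%:R * t < dot (map Posz y) z by exact: lt_le_trans ley.
apply/negP; rewrite -leNgt; apply: (le_trans (ler_norm _)).
rewrite -(ler_pXn2r (n := 2)) ?nnegrE ?mulr_ge0 // real_normK ?num_real //.
apply: (le_trans (cauchy_schwarz _ _)); rewrite tx exprMn.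
apply: ler_wpM2r; first exact: sqr_ge0.
by rewrite sumsq_nat -natrX ler_nat -mulnn.
Qed.

Lemma check_count n T I O : (0 < n)%N -> check n T I O ->
  {in I, forall c, t < dot c z} -> {in O, forall c, dot c z <= t} ->
  (2 * count (fun c => (t < dot c z)%R) (signs n) <= 2 ^ n.-1)%N.
Proof.
move=> n0; elim: T I O => [|ws y|s T1 IH1 T2 IH2] I O /=.
- by move=> ? _; exact: few_count.
- by move=> /void_false vI /vI.
case/andP=> ch1 ch2 It Ot; have [lt|le] := ltP t (dot (signvec s) z).
  apply: IH1 ch1 _ _ => c; rewrite inE => /predU1P[->|] //; [exact: It| | exact: Ot].
  by rewrite dot_oppv; move: t0 lt; lra.
by apply: IH2 ch2 It _ => c; rewrite inE => /predU1P[->|] //; exact: Ot.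
Qed.

End Soundness.

(** * The certificate *)

Local Open Scope string_scope.

(** A node [Branch s (Void _ _) T] shows that [s] lies outside [F], and with it
    every sign vector that [s] dominates. *)
Definition certificate : tree :=
  Branch "+-+-+-++-" (
   Branch "-++++++++" (Void [:: (7, "+-+-+-++-"); (1, "-++++++++")] [:: 6; 2; 2; 2; 2; 2; 2; 2; 0]) (
   Few))
  (
   Branch "++-+-+-+-" (
    Branch "-++++-+-+" (Void [:: (1, "++-+-+-+-"); (1, "-++++-+-+")] [:: 1; 1; 1; 1; 0; 0; 0; 0; 0]) (
    Branch "--+++++++" (Void [:: (2, "++-+-+-+-"); (1, "--+++++++")] [:: 1; 1; 1; 1; 1; 1; 1; 1; 0]) (
    Branch "++-+--+--" (
     Branch "-+++++-++" (Void [:: (1, "++-+--+--"); (1, "-+++++-++")] [:: 1; 1; 1; 1; 0; 0; 0; 0; 0]) (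
     Branch "+-+++--+-" (
      Branch "-++++++++" (Void [:: (2, "++-+--+--"); (1, "+-+++--+-"); (1, "-++++++++")] [:: 2; 2; 2; 2; 0; 0; 0; 0; 0]) (
      Few))
     (
      Branch "++--+--++" (
       Branch "-++++++++" (Void [:: (2, "++-+--+--"); (1, "++--+--++"); (2, "-++++++++")] [:: 3; 3; 1; 1; 1; 1; 1; 1; 1]) (
       Few))
      (
       Branch "+-+++-+-+" (
        Branch "++--+-++-" (
         Branch "-++++++++" (Void [:: (1, "++-+--+--"); (1, "++--+-++-"); (1, "+-+++-+-+"); (1, "-++++++++")] [:: 2; 2; 2; 1; 1; 1; 1; 0; 0]) (
         Few))
        (
         Few))
       (
        Few)))))
    (
     Branch "+-+-+++-+" (
      Branch "-++++++-+" (Void [:: (3, "++-+-+-+-"); (2, "+-+-+++-+"); (1, "-++++++-+")] [:: 4; 2; 2; 2; 2; 2; 0; 0; 0]) (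
      Branch "++-+--+-+" (
       Branch "-++++++++" (Void [:: (3, "++-+--+-+"); (1, "+-+-+++-+"); (1, "-++++++++")] [:: 3; 3; 1; 1; 1; 1; 1; 1; 1]) (
       Few))
      (
       Branch "+-+++---+" (
        Branch "-++++++++" (Void [:: (2, "++-+-+-+-"); (2, "+-+++---+"); (1, "+-+-+++-+"); (1, "-++++++++")] [:: 4; 2; 2; 2; 2; 2; 0; 0; 0]) (
        Few))
       (
        Branch "+++--+---" (
         Branch "-++++++++" (Void [:: (1, "+++--+---"); (2, "++-+-+-+-"); (2, "+-+-+++-+"); (1, "-++++++++")] [:: 4; 2; 2; 2; 2; 2; 0; 0; 0]) (
         Few))
        (
         Branch "+-+-+-+++" (
          Branch "-++++++++" (Void [:: (4, "++-+-+-+-"); (3, "+-+-+-+++"); (1, "-++++++++")] [:: 6; 2; 2; 2; 2; 2; 2; 2; 0]) (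
          Few))
         (
          Few))))))
     (
      Branch "+-+++-+--" (
       Branch "-++-+++++" (Void [:: (1, "++-+-+-+-"); (1, "+-+++-+--"); (1, "-++-+++++")] [:: 1; 1; 1; 1; 1; 1; 1; 1; 0]) (
       Branch "++-+--+-+" (
        Branch "-+++++-++" (Void [:: (2, "++-+--+-+"); (1, "+-+++-+--"); (1, "-+++++-++")] [:: 2; 2; 2; 2; 0; 0; 0; 0; 0]) (
        Branch "++--++-+-" (
         Branch "-++++++++" (Void [:: (1, "++-+--+-+"); (1, "++--++-+-"); (1, "+-+++-+--"); (1, "-++++++++")] [:: 2; 2; 2; 1; 1; 1; 1; 0; 0]) (
         Few))
        (
         Branch "+-++-+-+-" (
          Branch "-+++++++-" (Void [:: (2, "++-+--+-+"); (1, "+-++-+-+-"); (1, "-+++++++-")] [:: 2; 2; 2; 2; 0; 0; 0; 0; 0]) (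
          Few))
         (
          Few))))
       (
        Branch "+++--+---" (
         Branch "-++++-+++" (Void [:: (1, "+++--+---"); (1, "++-+-+-+-"); (1, "+-+++-+--"); (1, "-++++-+++")] [:: 2; 2; 2; 2; 0; 0; 0; 0; 0]) (
         Branch "++--++-+-" (
          Branch "-++++++++" (Void [:: (1, "+++--+---"); (2, "++--++-+-"); (2, "+-+++-+--"); (1, "-++++++++")] [:: 4; 2; 2; 2; 2; 2; 0; 0; 0]) (
          Few))
         (
          Branch "+-++-+-+-" (
           Branch "-+++++-+-" (
            Branch "++--+++++" (Void [:: (1, "+++--+---"); (1, "++--+++++"); (3, "+-++-+-+-"); (1, "-+++++-+-")] [:: 4; 2; 2; 2; 2; 2; 0; 0; 0]) (
            Few))
           (
            Few))
          (
           Few))))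
        (
         Branch "-+++++-+-" (
          Branch "++--+++-+" (Void [:: (2, "++-+-+-+-"); (1, "++--+++-+"); (2, "+-+++-+--"); (1, "-+++++-+-")] [:: 4; 2; 2; 2; 2; 2; 0; 0; 0]) (
          Few))
         (
          Few)))))
      (
       Branch "-+++++-+-" (
        Branch "++-+--+-+" (Void [:: (1, "++-+--+-+"); (1, "-+++++-+-")] [:: 1; 1; 1; 1; 0; 0; 0; 0; 0]) (
        Branch "+++--+---" (
         Branch "++--+-+++" (Void [:: (1, "+++--+---"); (2, "++--+-+++"); (2, "-+++++-+-")] [:: 3; 3; 1; 1; 1; 1; 1; 1; 0]) (
         Branch "-++-+++++" (Void [:: (1, "+++--+---"); (1, "++-+-+-+-"); (2, "-++-+++++")] [:: 2; 2; 2; 1; 1; 1; 1; 0; 0]) (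
         Few)))
        (
         Branch "++--++-+-" (
          Branch "+-+++-+-+" (Void [:: (3, "++--++-+-"); (2, "+-+++-+-+"); (1, "-+++++-+-")] [:: 4; 2; 2; 2; 2; 2; 0; 0; 0]) (
          Few))
         (
          Few))))
       (
        Branch "++-+--+-+" (
         Branch "-++-+++++" (Void [:: (3, "++-+--+-+"); (2, "-++-+++++")] [:: 3; 3; 1; 1; 1; 1; 1; 1; 1]) (
         Branch "++--+-++-" (
          Branch "+-+++-++-" (
           Branch "-++++++++" (Void [:: (2, "++-+--+-+"); (1, "++--+-++-"); (1, "+-+++-++-"); (1, "-++++++++")] [:: 3; 3; 1; 1; 1; 1; 1; 1; 1]) (
           Few))
          (
           Few))
         (
          Few)))
        (
         Branch "+-+++-++-" (
          Branch "+++--+---" (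
           Branch "-++-+++++" (Void [:: (1, "+++--+---"); (1, "++-+-+-+-"); (2, "-++-+++++")] [:: 2; 2; 2; 1; 1; 1; 1; 0; 0]) (
           Few))
          (
           Few))
         (
          Few)))))))))
   (
    Branch "+-++-++-+" (
     Branch "-++++--+-" (Void [:: (1, "+-++-++-+"); (1, "-++++--+-")] [:: 1; 1; 1; 1; 0; 0; 0; 0; 0]) (
     Branch "+++-+---+" (
      Branch "-++-++++-" (Void [:: (1, "+++-+---+"); (1, "+-++-++-+"); (2, "-++-++++-")] [:: 2; 2; 2; 1; 1; 1; 1; 0; 0]) (
      Branch "-+-++++++" (Void [:: (1, "+++-+---+"); (1, "+-++-++-+"); (1, "-+-++++++")] [:: 1; 1; 1; 1; 1; 1; 1; 1; 1]) (
      Branch "-++++-+-+" (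
       Branch "++--++++-" (Void [:: (1, "+++-+---+"); (1, "++--++++-"); (1, "+-++-++-+"); (1, "-++++-+-+")] [:: 2; 2; 2; 1; 1; 1; 1; 0; 0]) (
       Branch "+++----+-" (Void [:: (1, "+++----+-"); (1, "+-++-++-+"); (2, "-++++-+-+")] [:: 2; 2; 2; 2; 0; 0; 0; 0; 0]) (
       Few)))
      (
       Branch "++--+-+++" (
        Branch "-++++++--" (Void [:: (1, "+++-+---+"); (1, "++--+-+++"); (1, "+-++-++-+"); (1, "-++++++--")] [:: 2; 2; 2; 1; 1; 1; 1; 0; 0]) (
        Few))
       (
        Branch "+++---+-+" (
         Branch "+-+-+++-+" (
          Branch "-+++++-+-" (Void [:: (1, "+++---+-+"); (2, "+-+-+++-+"); (1, "-+++++-+-")] [:: 2; 2; 2; 1; 1; 1; 1; 0; 0]) (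
          Few))
         (
          Few))
        (
         Branch "+-+-+++-+" (
          Branch "-++++-++-" (Void [:: (1, "+++-+---+"); (2, "+-+-+++-+"); (1, "-++++-++-")] [:: 2; 2; 2; 1; 1; 1; 1; 0; 0]) (
          Few))
         (
          Few)))))))
     (
      Branch "-++-++++-" (
       Branch "++-++--++" (Void [:: (1, "++-++--++"); (1, "+-++-++-+"); (1, "-++-++++-")] [:: 1; 1; 1; 1; 1; 1; 1; 1; 1]) (
       Few))
      (
       Branch "++--+-+++" (
        Branch "-+++++-+-" (Void [:: (1, "++--+-+++"); (1, "+-++-++-+"); (1, "-+++++-+-")] [:: 1; 1; 1; 1; 1; 1; 1; 1; 1]) (
        Few))
       (
        Branch "-++++-+-+" (
         Branch "++--++-++" (Void [:: (1, "++--++-++"); (1, "+-++-++-+"); (1, "-++++-+-+")] [:: 1; 1; 1; 1; 1; 1; 1; 1; 1]) (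
         Few))
        (
         Few))))))
    (
     Branch "++-++-++-" (
      Branch "+-+++-+-+" (
       Branch "+++--+-+-" (
        Branch "-++-++++-" (Void [:: (1, "+++--+-+-"); (2, "+-+++-+-+"); (1, "-++-++++-")] [:: 2; 2; 2; 1; 1; 1; 1; 0; 0]) (
        Branch "-++++-+-+" (
         Branch "++--++++-" (Void [:: (1, "+++--+-+-"); (1, "++--++++-"); (2, "-++++-+-+")] [:: 2; 2; 2; 1; 1; 1; 1; 0; 0]) (
         Few))
        (
         Few)))
       (
        Few))
      (
       Few))
     (
      Few)))).

Local Close Scope string_scope.

(** The zero vector is listed as a vector with [c.z <= t] from the start, so that
    the sign vectors without a positive prefix sum count as outside [F]. *)
Lemma certificate_valid : check 9 certificate [::] [:: nseq 9 0].
Proof. by vm_compute. Qed.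

(** * Signed sums of a real vector *)

Definition sums {R : realType} (x : seq R) : seq R :=
  foldr (fun r s => map (+%R r) s ++ map (+%R (- r)) s) [:: 0] x.

Lemma sumsE (R : realType) (x : seq R) : sums x = [seq dot c x | c <- signs (size x)].
Proof.
elim: x => //= r x ->; rewrite map_cat -!map_comp.
by congr (_ ++ _); apply: eq_map => c /=; rewrite ?mul1r ?mulN1r.
Qed.

Lemma size_sums (R : realType) (x : seq R) : size (sums x) = (2 ^ size x)%N.
Proof. by elim: x => //= r x IH; rewrite size_cat !size_map IH addnn -mul2n expnS. Qed.

Lemma perm_sums_cons (R : realType) (r : R) x y :
  perm_eq (sums x) (sums y) -> perm_eq (sums (r :: x)) (sums (r :: y)).
Proof. by move=> xy; apply: perm_cat; apply: perm_map. Qed.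

Lemma perm_sums_swap (R : realType) (r q : R) x :
  perm_eq (sums [:: r, q & x]) (sums [:: q, r & x]).
Proof.
rewrite /= !map_cat -!map_comp -!catA.
have sw (u v : R) : map (+%R u \o +%R v) (sums x) = map (+%R v \o +%R u) (sums x).
  by apply: eq_map => s /=; rewrite addrCA.
rewrite (sw r q) (sw r (- q)) (sw (- r) q) (sw (- r) (- q)).
by rewrite perm_cat2l perm_catCA.
Qed.

(** Adjacent swaps bring any entry to the front. *)
Lemma perm_sums (R : realType) (x y : seq R) : perm_eq x y -> perm_eq (sums x) (sums y).
Proof.
have front (r : R) (s : seq R) : r \in s -> perm_eq (sums s) (sums (r :: rem r s)).
  elim: s => // q s IH; rewrite inE /=; case: (eqVneq r q) => [->|rq] /= rs.
    exact: perm_refl.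
  apply: perm_trans (perm_sums_swap _ _ _).
  exact: perm_sums_cons (IH rs).
elim: x y => [|r x IH] y; first by move/perm_size/esym/size0nil ->.
move=> rxy; have ry : r \in y by rewrite -(perm_mem rxy) mem_head.
rewrite perm_sym; apply: perm_trans (front _ _ ry) _; rewrite perm_sym.
apply/perm_sums_cons/IH; rewrite -(perm_cons r); apply: perm_trans rxy _.
exact: perm_to_rem.
Qed.

Lemma perm_sums_norm (R : realType) (x : seq R) :
  perm_eq (sums (map Num.norm x)) (sums x).
Proof.
elim: x => // r x IH; apply: (perm_trans (perm_sums_cons `|r| IH)) => /=.
have [_|_] := ger0P r; first exact: perm_refl.
by rewrite opprK perm_catC perm_refl.
Qed.

Lemma perm_sums_opp (R : realType) (x : seq R) : perm_eq (map -%R (sums x)) (sums x).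
Proof.
rewrite sumsE -map_comp.
have -> : [seq (-%R \o (fun c => dot c x)) c | c <- signs (size x)] =
    [seq dot c x | c <- map oppv (signs (size x))].
  by rewrite -map_comp; apply: eq_map => c /=; rewrite dot_oppv.
by rewrite perm_map // oppv_signs.
Qed.

Lemma count_sums_zeros (R : realType) (p : pred R) k x :
  count p (sums (nseq k 0 ++ x)) = (2 ^ k * count p (sums x))%N.
Proof.
elim: k => [|k IH]; first by rewrite mul1n.
rewrite /= count_cat oppr0 (@eq_map _ _ _ id) ?map_id; last exact: add0r.
by rewrite IH expnS addnn -mul2n mulnA.
Qed.

(** By symmetry, as many sums lie below [- t] as above [t]. *)
Lemma count_sums_le_norm (R : realType) (x : seq R) (t : R) : 0 <= t ->
  (count (fun s => `|s| <= t)%R (sums x) + 2 * count (fun s => t < s)%R (sums x)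
    = 2 ^ size x)%N.
Proof.
move=> t0; rewrite -size_sums -(count_predC (fun s => `|s| <= t)) mul2n -addnn.
congr (_ + _)%N; rewrite -[X in (_ + X)%N](permP (perm_sums_opp x)) count_map.
rewrite -count_predUI [X in (_ + X)%N](_ : _ = 0%N) ?addn0.
  by apply: eq_count => s /=; rewrite -ltNge lter_normr.
rewrite -(count_pred0 (sums x)); apply: eq_count => s /=.
by apply/negbTE/negP => /andP[]; lra.
Qed.

Lemma sorted_case (R : realType) (z : seq R) (t : R) :
  size z = 9%N -> sorted >=%R z -> all (>= 0) z -> 0 <= t -> sumsq z = t ^+ 2 ->
  (2 ^ 8 <= count (fun s => `|s| <= t)%R (sums z))%N.
Proof.
case: z => // r z size_z z_sorted z_ge0 t0 zt; have /andP[r0 z0] := z_ge0.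
have mono : nonincr r (r :: z) by apply: nonincr_sorted; rewrite //= lexx.
have zeros_le : {in [:: nseq 9 0], forall c, dot c (r :: z) <= t}.
  move=> c; rewrite inE => /eqP ->.
  suff -> k (x : seq R) : dot (nseq k 0) x = 0 by [].
  by elim: k x => [|k IH] [|q x] //=; rewrite IH mul0r addr0.
have nil_lt : {in [::], forall c, t < dot c (r :: z)} by [].
have := check_count mono t0 zt (isT : 0 < 9)%N certificate_valid nil_lt zeros_le.
have := count_sums_le_norm (r :: z) t0.
rewrite size_z sumsE size_z !count_map => total bound.
rewrite -(leq_add2r (2 ^ 8)) addnn -mul2n -expnS -total leq_add2l.
exact: bound.
Qed.

(** * Reduction to the sorted case *)

Lemma dot_map (R : realType) (T : Type) (s : seq T) (f : T -> int) (g : T -> R) :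
  dot (map f s) (map g s) = \sum_(i <- s) (f i)%:~R * g i.
Proof. by elim: s => [|i s IH] /=; rewrite ?big_nil // big_cons IH. Qed.

Definition entries {R : realType} {n} (a : 'rV[R]_n) : seq R := [seq a 0 i | i <- enum 'I_n].

(** The sign lists of the functions [e] are distinct and as many as there are
    members of [signs n], so they are these members in some order. *)
Lemma card_signed_sum (R : realType) (n : nat) (a : 'rV[R]_n) (p : pred R) :
  #|[set e : {ffun 'I_n -> bool} | p (signed_sum e a)]| = count p (sums (entries a)).
Proof.
pose code (e : {ffun 'I_n -> bool}) : seq int := [seq (-1) ^+ e i | i <- enum 'I_n].
have code_inj : injective code.
  move=> e f /eq_in_map ef; apply/ffunP => i.
  have := ef i (mem_enum _ _); by case: (e i); case: (f i).
have codeS : perm_eq (map code (enum {ffun 'I_n -> bool})) (signs n).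
  have ucode : uniq (map code (enum {ffun 'I_n -> bool})) by rewrite map_inj_uniq ?enum_uniq.
  have sub : {subset map code (enum {ffun 'I_n -> bool}) <= signs n}.
    move=> _ /mapP[e _ ->]; rewrite mem_signs size_map size_enum_ord eqxx /=.
    by apply/allP => _ /mapP[i _ ->]; case: (e i).
  have sz : size (map code (enum {ffun 'I_n -> bool})) = size (signs n).
    by rewrite size_map -cardE card_ffun card_bool card_ord size_signs.
  have [_ memE] := uniq_min_size ucode sub (eq_leq (esym sz)).
  apply: uniq_perm => //.
  by rewrite -(eq_uniq sz memE).
rewrite sumsE size_map size_enum_ord count_map -(permP codeS) count_map.
rewrite cardsE cardE size_filter -enumT; apply: eq_count => e /=.
rewrite unfold_in /=; congr p; rewrite /signed_sum dot_map big_enum /=.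
by apply: eq_bigr => i _; rewrite rmorphXn rmorphN.
Qed.

Theorem theorem1p1 (R : realType) (n : nat) (n_gt0 : (0 < n)%N) (n_le9 : (n <= 9)%N)
    (a : 'rV[R]_n) :
  (2 ^ n.-1 <=
    #|[set e : {ffun 'I_n -> bool} | (`|signed_sum e a| <= enorm a)%R]|)%N.
Proof.
set t := enorm a; rewrite (card_signed_sum a (fun s => `|s| <= t)).
pose x := nseq (9 - n) 0 ++ entries a; pose z := sort >=%R (map Num.norm x).
have size_x : size x = 9%N.
  by rewrite size_cat size_nseq size_map size_enum_ord subnK.
have zx : perm_eq z (map Num.norm x) by rewrite perm_sort.
have t_ge0 : 0 <= t by exact: sqrtr_ge0.
have zt : sumsq z = t ^+ 2.
  rewrite sqr_sqrtr ?sumr_ge0 // => [|i _]; last exact: sqr_ge0.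
  rewrite /sumsq (perm_big _ zx) big_map big_cat big_nseq /= big_map big_enum /=.
  rewrite normr0 expr0n /= iter_addr_0 mul0rn add0r.
  by apply: eq_bigr => i _; rewrite real_normK ?num_real.
have := @sorted_case R z t; rewrite size_sort size_map size_x => /(_ erefl).
rewrite (permP (perm_sums zx)) (permP (perm_sums_norm x)) count_sums_zeros.
have -> : (2 ^ 8 = 2 ^ (9 - n) * 2 ^ n.-1)%N.
  by rewrite -expnD -(prednK n_gt0) in n_le9 *; rewrite subSS subnK.
rewrite leq_pmul2l ?expn_gt0 //; apply=> //.
- by apply: sort_sorted => p q; rewrite le_total.
- by rewrite all_sort; apply/allP => _ /mapP[r _ ->]; exact: normr_ge0.
Qed.
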